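(* For a bounded subset $A$ of a barrelled locally convex space $E$ the following assertions are equivalent: (i) $A$ is a $(1,\infty)$-limited set; (ii) $T(A)$ is relatively compact for every operator $T:E\to \ell_1$; (iii) for any weak$^\ast$ $1$-summable sequence $\{\chi_n\}_{n\in\omega}$ in $E'$, it follows that \[ \lim_{m\to\infty} \sup\Big\{ \sum_{n\geq m} |\langle \chi_n,x\rangle|: x\in A\Big\}=0. \]
   Context: All locally convex spaces are Hausdorff, over $\mathbb{F}\in\{\mathbb{R},\mathbb{C}\}$; $\omega=\{0,1,2,\dots\}$; ''operator'' means continuous linear map; $A$ is non-empty. $E'$ is the topological dual of $E$. $E$ is barrelled if every $\sigma(E',E)$-bounded subset of $E'$ is equicontinuous. A sequence $\{\chi_n\}_{n\in\omega}$ in $E'$ is weak$^\ast$ $1$-summable if $(\langle\chi_n,x\rangle)_n\in\ell_1$ for every $x\in E$. A non-empty subset $A$ of $E$ is $(1,\infty)$-limited if $\sup_{x\in A}|\langle\chi_n,x\rangle|\to0$ for every weak$^\ast$ $1$-summable sequence $\{\chi_n\}$ in $E'$. *)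

(* Defs.v *)
From HB Require Import structures.
From mathcomp Require Import all_boot all_order all_algebra.
From mathcomp Require Import all_classical all_reals all_analysis.
From mathcomp Require Import complex.

Set Implicit Arguments.
Unset Strict Implicit.
Unset Printing Implicit Defensive.

Import Order.TTheory GRing.Theory Num.Theory.
Import numFieldNormedType.Exports.

Local Open Scope classical_set_scope.
Local Open Scope ring_scope.

Inductive scalar_kind := RealScalars | ComplexScalars.

Definition scalars (R : realType) (k : scalar_kind) : numFieldType :=
  match k with
  | RealScalars => R : numFieldType
  | ComplexScalars => R[i] : numFieldType
  end.

Definition of_real (R : realType) (k : scalar_kind) : R -> scalars R k :=
  match k return R -> scalars R k with
  | RealScalars => fun r => r
  | ComplexScalars => fun r => (r +i* 0)%C
  end.

(* The norm of [numFieldType] is valued in the field itself, hence in R[i] in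
   the complex case; [modulus] is the same norm read in R. *)
Definition modulus (R : realType) (k : scalar_kind) : scalars R k -> R :=
  match k return scalars R k -> R with
  | RealScalars => fun x => `|x|
  | ComplexScalars => fun z => complex.Re `|z|
  end.

Section modulus_theory.
Context {R : realType} {k : scalar_kind}.
Implicit Types x y : scalars R k.

Lemma of_realD : {morph @of_real R k : r s / r + s}.
Proof. by case: k => r s //=; apply/eqP; rewrite eq_complex /= addr0 !eqxx. Qed.

Lemma of_realM : {morph @of_real R k : r s / r * s}.
Proof.
by case: k => r s //=; apply/eqP; rewrite eq_complex /= !mulr0 mul0r subr0 addr0 !eqxx.
Qed.

Lemma of_real_inj : injective (@of_real R k).
Proof. by case: k => r s //= [->]. Qed.

Lemma ler_of_real (r s : R) : (of_real k r <= of_real k s) = (r <= s).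
Proof. by case: k => //=; rewrite lecE /= eqxx. Qed.

Lemma of_real_modulus x : of_real k (modulus x) = `|x|.
Proof. by case: k x. Qed.

Lemma modulus_ge0 x : 0 <= modulus x.
Proof.
have := normr_ge0 x; rewrite -of_real_modulus.
suff -> : 0 = of_real k 0 by rewrite ler_of_real.
by case: k {x}.
Qed.

Lemma modulusM x y : modulus (x * y) = modulus x * modulus y.
Proof. by apply: of_real_inj; rewrite of_realM !of_real_modulus normrM. Qed.

Lemma ler_modulusD x y : modulus (x + y) <= modulus x + modulus y.
Proof. by rewrite -ler_of_real of_realD !of_real_modulus ler_normD. Qed.

Lemma modulus0 : modulus (0 : scalars R k) = 0.
Proof.
apply: of_real_inj; rewrite of_real_modulus normr0.
by case: k.
Qed.

Lemma modulus_eq0 x : modulus x = 0 -> x = 0.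
Proof.
move=> x0; apply/eqP; rewrite -normr_eq0 -of_real_modulus x0.
by case: k {x x0}.
Qed.

End modulus_theory.

Definition tail_sum (R : realType) (k : scalar_kind)
    (u : nat -> (scalars R k)^o) (m : nat) : \bar R :=
  (\sum_(m <= n <oo) (modulus (u n))%:E)%E.

Definition abs_summable (R : realType) (k : scalar_kind)
    (u : nat -> (scalars R k)^o) : Prop :=
  (tail_sum u 0 < +oo)%E.

Section ell1.
Context (R : realType) (k : scalar_kind).
Local Notation K := (scalars R k).

Definition ell1_pred : {pred nat -> K^o} :=
  mem [set u : nat -> K^o | abs_summable u].

Lemma tail_sumD (u v : nat -> K^o) m :
  (tail_sum (u + v)%R m <= tail_sum u m + tail_sum v m)%E.
Proof.
rewrite /tail_sum -nneseriesD//; try by move=> *; rewrite lee_fin modulus_ge0.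
apply: lee_nneseries => [n _|n _]; first by rewrite lee_fin modulus_ge0.
by rewrite -EFinD lee_fin ler_modulusD.
Qed.

Lemma tail_sumZ (a : K) (u : nat -> K^o) m :
  tail_sum (a *: u) m = ((modulus a)%:E * tail_sum u m)%E.
Proof.
rewrite /tail_sum -nneseriesZl//; last by move=> *; rewrite lee_fin modulus_ge0.
by apply: eq_eseriesr => n _; rewrite -EFinM -modulusM.
Qed.

Lemma tail_sum_ge0 (u : nat -> K^o) m : (0 <= tail_sum u m)%E.
Proof. by apply: nneseries_ge0 => *; rewrite lee_fin modulus_ge0. Qed.

Lemma ell1_submod_closed : submod_closed ell1_pred.
Proof.
split=> [|a u v].
  rewrite inE /= /abs_summable /tail_sum eseries0// => n _ _.
  by rewrite /= modulus0.
rewrite !inE /= /abs_summable => u1 v1.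
rewrite (le_lt_trans (tail_sumD _ _ _))// lte_add_pinfty//.
by rewrite tail_sumZ lte_mul_pinfty// lee_fin modulus_ge0.
Qed.

HB.instance Definition _ :=
  GRing.isSubmodClosed.Build K (nat -> K^o) ell1_pred ell1_submod_closed.

Record ell1 := Ell1 { ell1_seq :> nat -> K^o ; _ : ell1_seq \in ell1_pred }.

HB.instance Definition _ := [isSub for ell1_seq].
HB.instance Definition _ := [Choice of ell1 by <:].
HB.instance Definition _ := [SubChoice_isSubLmodule of ell1 by <:].

Definition ell1_norm (u : ell1) : K := of_real k (fine (tail_sum u 0)).

Lemma ell1_fin_num (u : ell1) : tail_sum u 0 \is a fin_num.
Proof.
rewrite ge0_fin_numE ?tail_sum_ge0//.
by case: u => u /=; rewrite inE.
Qed.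

Lemma ler_ell1_normD (u v : ell1) :
  ell1_norm (u + v) <= ell1_norm u + ell1_norm v.
Proof.
rewrite /ell1_norm -of_realD ler_of_real -lee_fin EFinD !fineK ?ell1_fin_num//.
exact: tail_sumD.
Qed.

Lemma ell1_normZ (a : K) (u : ell1) : ell1_norm (a *: u) = `|a| * ell1_norm u.
Proof.
rewrite /ell1_norm -of_real_modulus -of_realM; congr of_real.
by apply: EFin_inj; rewrite EFinM !fineK ?ell1_fin_num// -tail_sumZ.
Qed.

Lemma ell1_norm0_eq0 (u : ell1) : ell1_norm u = 0 -> u = 0.
Proof.
move=> u0; apply: val_inj; apply/funext => n /=.
have {}u0 : tail_sum u 0 = 0%E.
  rewrite -(fineK (ell1_fin_num u)); congr EFin; apply: (@of_real_inj R k).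
  by move: u0; rewrite /ell1_norm => ->; case: (k).
apply: modulus_eq0; apply: EFin_inj.
have H := @nneseries_lim_ge R (fun n => (modulus (u n))%:E) xpredT 0 n.+1.
apply/eqP; rewrite eq_le; apply/andP; split; last by rewrite lee_fin modulus_ge0.
rewrite -[leRHS]u0 (le_trans _ (H _))//; last first.
  by move=> *; rewrite lee_fin modulus_ge0.
rewrite big_nat_recr//= leeDr// sume_ge0// => *.
by rewrite lee_fin modulus_ge0.
Qed.

HB.instance Definition _ := Lmodule_isNormed.Build K ell1
  ler_ell1_normD ell1_normZ ell1_norm0_eq0.

End ell1.

Section dual.
Context (K : numFieldType) (E : tvsType K).

Definition dual_pred : {pred E -> K^o} :=
  mem [set f : E -> K^o | linear f /\ continuous f].

Lemma dual_submod_closed : submod_closed dual_pred.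
Proof.
split=> [|a f g].
  rewrite inE /=; split; first by move=> a x y /=; rewrite scaler0 addr0.
  exact: cst_continuous.
rewrite !inE /= => -[lf cf] [lg cg]; split => [b x y|x].
  rewrite !fctE lf lg !scalerDr !scalerA addrACA.
  by rewrite (mulrC a b).
apply: (@cvgD K K^o _ _ _ (a *: f) g) (cg x).
exact: (@cvgZl_tmp K K^o _ _ _ a f _ (cf x)).
Qed.

HB.instance Definition _ :=
  GRing.isSubmodClosed.Build K (E -> K^o) dual_pred dual_submod_closed.

Record dual := Dual { dual_fun :> E -> K^o ; _ : dual_fun \in dual_pred }.

HB.instance Definition _ := [isSub for dual_fun].
HB.instance Definition _ := [Choice of dual by <:].
HB.instance Definition _ := [SubChoice_isSubLmodule of dual by <:].

(* The weak* topology sigma(E', E). *)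
HB.instance Definition _ := Topological.copy dual
  (initial_topology (dual_fun : dual -> {ptws E -> K^o})).

Lemma dual_linear (f : dual) : linear (f : E -> K^o).
Proof. by have := valP f; rewrite inE => -[]. Qed.

HB.instance Definition _ (f : dual) :=
  GRing.isLinear.Build K E K^o *:%R (dual_fun f) (dual_linear f).

Lemma dual_continuous (f : dual) : continuous (f : E -> K^o).
Proof. by have := valP f; rewrite inE => -[]. Qed.

End dual.

(* Von Neumann boundedness: every neighbourhood of 0 absorbs A. *)
Definition tvs_bounded (K : numFieldType) (V : preTopologicalLmodType K)
    (A : set V) : Prop :=
  forall U : set V, nbhs 0 U ->
    exists2 r : K, 0 < r & forall l : K, r <= `|l| -> A `<=` ( *:%R l @` U).

Definition barrelled (K : numFieldType) (E : tvsType K) : Prop :=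
  forall B : set (dual E), tvs_bounded B ->
    equicontinuous B (fun f : dual E => (f : E -> K^o)).

Section limited.
Context (R : realType) (k : scalar_kind) (E : tvsType (scalars R k)).

Definition weak_star_1_summable (chi : nat -> dual E) : Prop :=
  forall x : E, abs_summable (fun n => chi n x).

Definition limited_1_infty (A : set E) : Prop :=
  A !=set0 /\
  forall chi : nat -> dual E, weak_star_1_summable chi ->
    ereal_sup [set (modulus (chi n x))%:E | x in A] @[n --> \oo] --> 0%E.

End limited.

(* Main.v *)
Require Import Defs.
From HB Require Import structures.
From mathcomp Require Import all_boot all_order all_algebra.
From mathcomp Require Import all_classical all_reals all_analysis.
From mathcomp Require Import complex lra.
Import Order.TTheory GRing.Theory Num.Theory.
Import numFieldNormedType.Exports.
Local Open Scope classical_set_scope.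
Local Open Scope ring_scope.

(** The three conditions are linked through uniform smallness of tails.

    A set that is uniformly small on every weak* 1-summable sequence has
    uniformly small tails, by a gliding hump ([limited_uniform_tails]).  If the
    tails of [chi] were not uniformly small on [A], one could cut the integers
    into consecutive blocks, each carrying a point of [A] on which the sum of
    the moduli over the block stays above a fixed [e].  Multiplying the
    functionals of a block by scalars of modulus at most 1 that undo the phases
    at that point, and adding them up, gives one functional per block.  These
    block functionals are dominated blockwise by [chi], so they are again
    weak* 1-summable, yet each exceeds [e] somewhere on [A].  The converse is
    immediate, since a term is bounded by the tail that it starts.

    Operators into ell1 and weak* 1-summable sequences are the same thing: the
    coordinates of an operator form such a sequence, and conversely a sequence
    [chi] defines the map sending [x] to the sequence of the [chi n x].  The
    continuity of this map is where barrelledness enters: the finite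
    combinations of the [chi n] with coefficients of modulus at most 1 form a
    weak* bounded, hence equicontinuous, set, and the ell1 norm of the image of
    [x] is the supremum of the moduli of their values at [x].

    Under this correspondence, uniformly small tails on the bounded set [A] mean
    that the image of [A] is relatively compact.  A compact set of ell1 has
    uniformly small tails by a Dini argument ([compact_uniform_tails]);
    conversely, the set of all sequences whose tails are dominated by a fixed
    null sequence with finite first term is compact ([ell1_compact_tails]),
    because pointwise convergence on it, which holds along any ultrafilter,
    upgrades to norm convergence. *)

Set Implicit Arguments.
Unset Strict Implicit.

(** * Scalars, moduli and tail sums *)

Lemma ltr_of_real (R : realType) (k : scalar_kind) (r s : R) :
  (of_real k r < of_real k s) = (r < s).
Proof. by rewrite !lt_neqAle ler_of_real (inj_eq (@of_real_inj R k)). Qed.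

Lemma of_real0 (R : realType) (k : scalar_kind) : of_real k 0 = 0 :> scalars R k.
Proof. by case: k. Qed.

Lemma of_real1 (R : realType) (k : scalar_kind) : of_real k 1 = 1 :> scalars R k.
Proof. by case: k. Qed.

Lemma ge0_of_real (R : realType) (k : scalar_kind) (e : scalars R k) :
  0 <= e -> of_real k (modulus e) = e.
Proof. by move=> e0; rewrite of_real_modulus ger0_norm. Qed.

Lemma modulus_gt0 (R : realType) (k : scalar_kind) (e : scalars R k) :
  0 < e -> 0 < modulus e.
Proof. by move=> e0; rewrite -(ltr_of_real k) of_real0 ge0_of_real// ltW. Qed.

Lemma modulus_of_real (R : realType) (k : scalar_kind) (r : R) :
  0 <= r -> modulus (of_real k r) = r.
Proof.
move=> r0; apply: (@of_real_inj R k).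
by rewrite ge0_of_real// -(of_real0 R k) ler_of_real.
Qed.

Lemma unimodular_rotation (R : realType) (k : scalar_kind) (z : scalars R k) :
  exists2 t : scalars R k, modulus t <= 1 & t * z = of_real k (modulus z).
Proof.
have [->|z0] := eqVneq z 0.
  by exists 0; rewrite ?modulus0 ?mul0r ?of_real0.
exists (of_real k (modulus z) / z); last by rewrite divfK.
rewrite -(@ler_of_real R k) of_real_modulus normrM normfV of_real_modulus normr_id.
by rewrite mulfV ?normr_eq0// of_real1.
Qed.

Lemma modulus_sum (R : realType) (k : scalar_kind) I (r : seq I) (P : pred I)
    (F : I -> scalars R k) :
  modulus (\sum_(i <- r | P i) F i) <= \sum_(i <- r | P i) modulus (F i).
Proof.
elim/big_rec2: _ => [|i x y _ h]; first by rewrite modulus0.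
by rewrite (le_trans (ler_modulusD _ _))// lerD2l.
Qed.

Lemma sum_modulus_le_tail_sum (R : realType) (k : scalar_kind)
    (u : nat -> (scalars R k)^o) m N :
  ((\sum_(m <= n < N) modulus (u n))%:E <= tail_sum u m)%E.
Proof.
rewrite -sumEFin; apply: nneseries_lim_ge => n _ _.
by rewrite lee_fin modulus_ge0.
Qed.

Lemma tail_sum_leP (R : realType) (k : scalar_kind)
    (u : nat -> (scalars R k)^o) m (t : \bar R) :
  (tail_sum u m <= t)%E <->
  (forall N, ((\sum_(m <= n < N) modulus (u n))%:E <= t)%E).
Proof.
split=> [ut N|ut]; first exact: le_trans (sum_modulus_le_tail_sum _ _ _) ut.
apply: lime_le.
  by apply: is_cvg_nneseries => n _ _; rewrite lee_fin modulus_ge0.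
by apply: nearW => N; rewrite sumEFin.
Qed.

Lemma tail_sum_anti (R : realType) (k : scalar_kind)
    (u : nat -> (scalars R k)^o) m n : (m <= n)%N ->
  (tail_sum u n <= tail_sum u m)%E.
Proof.
move=> mn; rewrite /tail_sum [leRHS](nneseries_split _ (n - m)).
  rewrite subnKC// leeDr// sume_ge0// => i _.
  by rewrite lee_fin modulus_ge0.
by move=> *; rewrite lee_fin modulus_ge0.
Qed.

Lemma modulus_le_tail_sum (R : realType) (k : scalar_kind)
    (u : nat -> (scalars R k)^o) m :
  ((modulus (u m))%:E <= tail_sum u m)%E.
Proof.
by have := sum_modulus_le_tail_sum u m m.+1; rewrite big_nat1.
Qed.

Lemma cvge0_ge0P (R : realType) (a : nat -> \bar R) :
  (forall n, (0 <= a n)%E) ->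
  a @ \oo --> 0%E <-> forall e : R, 0 < e -> \forall n \near \oo, (a n <= e%:E)%E.
Proof.
move=> a0; split=> [/fine_cvgP[afin /cvgrPdist_le ca] e e0|ae].
  near=> n.
  have an : a n \is a fin_num by near: n.
  rewrite -(fineK an) lee_fin.
  have : `|0 - (fine \o a) n| <= e by near: n; exact: ca.
  by rewrite sub0r normrN ger0_norm//= fine_ge0.
apply/fine_cvgP; split.
  near=> n; rewrite ge0_fin_numE// (@le_lt_trans _ _ 1%:E) ?ltry//.
  by near: n; exact: ae.
apply/cvgrPdist_le => e e0; near=> n.
rewrite sub0r normrN ger0_norm ?fine_ge0//=.
rewrite -lee_fin fineK; first by near: n; exact: ae.
rewrite ge0_fin_numE// (@le_lt_trans _ _ e%:E) ?ltry//.
by near: n; exact: ae.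
Unshelve. all: by end_near. Qed.

Lemma ereal_sup_cvg0P (R : realType) (T : Type) (A : set T)
    (f : nat -> T -> \bar R) :
  A !=set0 -> (forall n x, (0 <= f n x)%E) ->
  ereal_sup [set f n x | x in A] @[n --> \oo] --> 0%E <->
  forall e : R, 0 < e -> \forall n \near \oo, forall x, A x -> (f n x <= e%:E)%E.
Proof.
move=> [x0 Ax0] f0; rewrite cvge0_ge0P => [|n]; last first.
  by apply: (le_trans (f0 n x0)); apply: ereal_sup_ubound; exists x0.
split=> h e /h; apply: filterS => n.
  by move=> sup_le x Ax; apply: le_trans sup_le; apply: ereal_sup_ubound; exists x.
by move=> fe; apply: ge_ereal_sup => _ [x Ax <-]; exact: fe.
Qed.

Lemma complex_normD (R : realType) (a b : R) :
  `|(a +i* b)%C| <= ((`|a| + `|b|) +i* 0)%C.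
Proof.
have -> : (a +i* b)%C = (a +i* 0)%C + (0 +i* b)%C.
  by apply/eqP; rewrite eq_complex /= addr0 add0r !eqxx.
apply: (le_trans (ler_normD _ _)); rewrite !normc_def /= expr0n /= addr0 add0r.
by rewrite !sqrtr_sqr lecE /= addr0 eqxx /=.
Qed.

(** A compact superset of the disc is enough to make bounded ultrafilters
    converge, and a square is easier to handle than the disc: over the complex
    numbers it is the image of a product of two segments. *)
Lemma compact_modulus_le (R : realType) (k : scalar_kind) (M : R) :
  exists2 C : set (scalars R k)^o, compact C & [set z | modulus z <= M] `<=` C.
Proof.
case: k => /=.
  exists (`[-M, M]%classic : set R); first exact: segment_compact.
  by move=> z /=; rewrite in_itv /= ler_norml.
pose f (p : R * R) : R[i]^o := (p.1 +i* p.2)%C.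
exists (f @` (`[-M, M]%classic `*` `[-M, M]%classic)).
  apply: continuous_compact; last by apply: compact_setX; exact: segment_compact.
  apply: continuous_subspaceT => p.
  apply/(@cvgrPdist_lt _ R[i]^o) => -[e e']; rewrite ltcE/= => /andP[/eqP-> e0].
  have e20 : 0 < e / 2 by exact: divr_gt0.
  have c1 : fst @ nbhs p --> p.1 by case: (p) => p1 p2; exact: cvg_fst.
  have c2 : snd @ nbhs p --> p.2 by case: (p) => p1 p2; exact: cvg_snd.
  near=> q.
  have q1 : `|p.1 - q.1| < e / 2.
    by near: q; apply: (@cvgr_dist_lt R R) c1 _ e20.
  have q2 : `|p.2 - q.2| < e / 2.
    by near: q; apply: (@cvgr_dist_lt R R) c2 _ e20.
  rewrite (le_lt_trans (complex_normD _ _))// ltcE /= eqxx /=.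
  by rewrite [ltRHS]splitr ltrD.
move=> [a b] /= h; exists (a, b) => //=; move: h; rewrite !in_itv /= -!ler_norml => h.
have r0 : 0 <= a ^+ 2 + b ^+ 2 by rewrite addr_ge0 ?sqr_ge0.
by split; apply: le_trans h; rewrite -sqrtr_sqr ler_sqrt// ?lerDl ?lerDr sqr_ge0.
Unshelve. all: by end_near. Qed.

(** * The gliding hump *)

Lemma dual_sumE (K : numFieldType) (E : tvsType K) I (r : seq I) (P : pred I)
    (a : I -> K) (f : I -> dual E) (x : E) :
  (\sum_(i <- r | P i) a i *: f i) x = \sum_(i <- r | P i) a i * f i x.
Proof. by elim/big_rec2: _ => [//|i y g _ <-]. Qed.

Lemma sum_rotation (R : realType) (k : scalar_kind) (z : nat -> scalars R k) m N :
  exists2 t : nat -> scalars R k, (forall n, modulus (t n) <= 1) &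
    \sum_(m <= n < N) t n * z n = of_real k (\sum_(m <= n < N) modulus (z n)).
Proof.
have /choice[t tz] : forall n, exists t : scalars R k,
    modulus t <= 1 /\ t * z n = of_real k (modulus (z n)).
  by move=> n; have [t] := unimodular_rotation (z n); exists t.
exists t => [n|]; first by have [] := tz n.
rewrite (big_morph (of_real k) (@of_realD R k) (of_real0 R k)).
by apply: eq_bigr => n _; have [] := tz n.
Qed.

Lemma modulus_sum_le (R : realType) (k : scalar_kind) (t z : nat -> scalars R k) m N :
  (forall n, modulus (t n) <= 1) ->
  modulus (\sum_(m <= n < N) t n * z n) <= \sum_(m <= n < N) modulus (z n).
Proof.
move=> t1; apply: (le_trans (modulus_sum _ _ _)); apply: ler_sum => n _.
by rewrite modulusM ler_piMl ?modulus_ge0.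
Qed.

Lemma abs_summableP (R : realType) (k : scalar_kind) (u : nat -> (scalars R k)^o) :
  abs_summable u <->
  exists M : R, forall N, \sum_(0 <= n < N) modulus (u n) <= M.
Proof.
split=> [us|[M uM]]; last first.
  by rewrite /abs_summable (@le_lt_trans _ _ M%:E) ?ltry//; apply/tail_sum_leP.
exists (fine (tail_sum u 0)) => N.
rewrite -lee_fin fineK; first exact: sum_modulus_le_tail_sum.
by rewrite ge0_fin_numE ?tail_sum_ge0.
Qed.

Section gliding_hump.
Context {R : realType} {k : scalar_kind} {E : tvsType (scalars R k)}.

(** Up to block [N] the moduli of the block functionals sum to at most the sum
    of the moduli of the [chi n] before [m N], because the blocks are disjoint
    and the coefficients have modulus at most 1. *)
Lemma weak_star_1_summable_blocks (chi : nat -> dual E) (m : nat -> nat)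
    (t : nat -> nat -> scalars R k) :
  weak_star_1_summable chi -> {homo m : i j / (i <= j)%N} ->
  (forall j n, modulus (t j n) <= 1) ->
  weak_star_1_summable (fun j => \sum_(m j <= n < m j.+1) t j n *: chi n).
Proof.
move=> chis mm t1 x; have /abs_summableP[M chiM] := chis x.
apply/abs_summableP; exists M => N; apply: le_trans (chiM (m N)).
have : \sum_(m 0 <= n < m N) modulus (chi n x) <= \sum_(0 <= n < m N) modulus (chi n x).
  rewrite [leRHS](@big_cat_nat _ _ _ (m 0))//= ?mm// lerDr sumr_ge0// => n _.
  exact: modulus_ge0.
apply: le_trans; elim: N => [|N ih]; first by rewrite !big_geq.
rewrite big_nat_recr//= [leRHS](@big_cat_nat _ _ _ (m N))/= ?mm// lerD//.
by rewrite dual_sumE; exact: modulus_sum_le.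
Qed.

(** If no tail were uniformly at most [e] on [A], then from every start [m] one
    could reach an end [g m] and a point [X m] of [A] on which the block from [m]
    to [g m] has mass above [e].  Iterating [g] from 0 produces the blocks;
    rotating each block at its own point gives a weak* 1-summable sequence that
    does not tend to 0 uniformly on [A]. *)
Lemma limited_uniform_tails (A : set E) (chi : nat -> dual E) :
  limited_1_infty A -> weak_star_1_summable chi ->
  forall e : R, 0 < e -> exists m, forall x, A x ->
    (tail_sum (fun n => chi n x) m <= e%:E)%E.
Proof.
move=> [A0 limA] chis e e0; apply: contrapT => /forallNP hump.
have /choice[g /choice[X gX]] : forall m, exists N, exists x, A x /\
    e < \sum_(m <= n < N) modulus (chi n x).
  move=> m; have /existsNP[x /not_implyP[Ax]] := hump m.
  rewrite tail_sum_leP => /existsNP[N]; rewrite lee_fin => /negP; rewrite -ltNge.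
  by exists N, x.
have g_gt m : (m < g m)%N.
  rewrite ltnNge; apply/negP => gm; have [_] := gX m.
  by rewrite big_geq// ltNge (ltW e0).
pose m j := iter j g 0%N.
have mm : {homo m : i j / (i <= j)%N}.
  by apply: homo_leq => [//|a b c /leq_trans|i]; [apply|exact: ltnW (g_gt _)].
have /choice[t tm] : forall j, exists t : nat -> scalars R k,
    (forall n, modulus (t n) <= 1) /\
    \sum_(m j <= n < m j.+1) t n * chi n (X (m j)) =
    of_real k (\sum_(m j <= n < m j.+1) modulus (chi n (X (m j)))).
  move=> j; have [t] := sum_rotation (fun n => chi n (X (m j))) (m j) (m j.+1).
  by exists t.
have /limA : weak_star_1_summable (fun j => \sum_(m j <= n < m j.+1) t j n *: chi n).
  by apply: weak_star_1_summable_blocks => // j; have [] := tm j.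
rewrite ereal_sup_cvg0P// => [/(_ e e0)[j _ /(_ j (leqnn j))]|n x]; last first.
  by rewrite lee_fin modulus_ge0.
have [AX eX] := gX (m j).
move=> /(_ _ AX); rewrite dual_sumE (tm j).2 lee_fin modulus_of_real.
  by rewrite leNgt eX.
by apply: ltW; exact: lt_trans eX.
Qed.

End gliding_hump.

(** * Compactness in ell1 *)

Lemma ell1_norm_le (R : realType) (k : scalar_kind) (u : ell1 R k) (e : R) :
  (`|u| <= of_real k e) = (tail_sum u 0 <= e%:E)%E.
Proof.
rewrite -[`|u|]/(of_real k (fine (tail_sum u 0))) ler_of_real.
by rewrite -lee_fin fineK// ell1_fin_num.
Qed.

Lemma ell1_cvgP (R : realType) (k : scalar_kind) (T : Type) (F : set_system T)
    {FF : Filter F} (f : T -> ell1 R k) (l : ell1 R k) :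
  f @ F --> l <-> forall e : R, 0 < e ->
    \forall x \near F, (tail_sum (l - f x : ell1 R k)%R 0 <= e%:E)%E.
Proof.
split=> [/cvgrPdist_le fl e e0|fl].
  have /fl : 0 < of_real k e by rewrite -(of_real0 R k) ltr_of_real.
  by apply: filterS => x; rewrite ell1_norm_le.
apply/cvgrPdist_le => e e0.
have /fl : 0 < modulus e by exact: modulus_gt0.
by apply: filterS => x; rewrite -ell1_norm_le ge0_of_real// ltW.
Qed.

Lemma tail_sum_head (R : realType) (k : scalar_kind) (u : nat -> (scalars R k)^o) m :
  tail_sum u 0 = ((\sum_(0 <= n < m) modulus (u n))%:E + tail_sum u m)%E.
Proof.
rewrite /tail_sum (nneseries_split _ m); first by rewrite sumEFin.
by move=> *; rewrite lee_fin modulus_ge0.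
Qed.

Lemma modulus_cvg (R : realType) (k : scalar_kind) (T : Type)
    (F : set_system T) {FF : Filter F} (u : T -> (scalars R k)^o)
    (l : (scalars R k)^o) :
  u x @[x --> F] --> l -> modulus (u x) @[x --> F] --> modulus l.
Proof.
move=> /cvgrPdist_lt ul; apply/cvgrPdist_lt => e e0.
have /ul : 0 < of_real k e by rewrite -(of_real0 R k) ltr_of_real.
apply: filterS => x; rewrite -(of_real_modulus (l - u x)) ltr_of_real.
apply: le_lt_trans; have lu := ler_modulusD (l - u x) (u x).
have ul' := ler_modulusD (u x - l) l.
have N : modulus (u x - l) = modulus (l - u x).
  by apply: (@of_real_inj R k); rewrite !of_real_modulus distrC.
rewrite !subrK N in lu ul'.
by rewrite ler_norml lerBlDr lu andbT lerNl opprB lerBlDr ul'.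
Qed.

(** Lower semicontinuity of the tail sums for pointwise convergence: only finite
    partial sums have to pass to the limit. *)
Lemma tail_sum_ptws_lim (R : realType) (k : scalar_kind) (T : Type)
    (F : set_system T) {FF : ProperFilter F} (u : T -> nat -> (scalars R k)^o)
    (l : nat -> (scalars R k)^o) m (t : \bar R) :
  (forall n, u x n @[x --> F] --> l n) ->
  (\forall x \near F, (tail_sum (u x) m <= t)%E) ->
  (tail_sum l m <= t)%E.
Proof.
move=> ul ut; apply/tail_sum_leP => N.
have : (\sum_(m <= n < N) modulus (u x n))%:E @[x --> F] -->
    (\sum_(m <= n < N) modulus (l n))%:E.
  apply: cvg_EFin; first exact: nearW.
  apply: cvg_big => [|n _]; last exact: modulus_cvg.
  exact: add_continuous.
apply: cvge_le; apply: filterS ut => x; apply: le_trans.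
exact: sum_modulus_le_tail_sum.
Qed.

Definition ell1_of (R : realType) (k : scalar_kind) (u : nat -> (scalars R k)^o)
  (us : abs_summable u) : ell1 R k := Ell1 (mem_set us).

Lemma tail_sumB (R : realType) (k : scalar_kind) (u v : nat -> (scalars R k)^o) m :
  (tail_sum (u - v)%R m <= tail_sum u m + tail_sum v m)%E.
Proof.
apply: (le_trans (tail_sumD _ _ _)); rewrite leeD2l// -scaleN1r tail_sumZ.
suff -> : modulus (-1 : scalars R k) = 1 by rewrite mul1e.
by apply: (@of_real_inj R k); rewrite of_real_modulus normrN1 of_real1.
Qed.

Lemma ultra_fmap (S T : Type) (f : S -> T) (F : set_system S) :
  UltraFilter F -> UltraFilter (f @ F).
Proof.
move=> UF; have PF : ProperFilter F by exact: ultra_proper.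
split; first exact: fmap_proper_filter.
move=> G PG fFG; rewrite eqEsubset; split => // B GB.
have [//|FB] := in_ultra_setVsetC (f @^-1` B) UF.
have /(filterI GB) : G (~` B) by apply: fFG.
by rewrite setICr => /filter_not_empty.
Qed.

(** Along an ultrafilter every coordinate converges, being bounded by [t 0].
    The limit obeys the same tail bounds, so it lies in the set.  Convergence in
    norm follows by splitting at an index [m] with [t m <= e / 4]: the two tails
    contribute at most [e / 2], and the finite head tends to 0. *)
Lemma ell1_compact_tails (R : realType) (k : scalar_kind) (t : nat -> \bar R) :
  (t 0%N < +oo)%E -> t @ \oo --> 0%E ->
  compact [set u : ell1 R k | forall m, (tail_sum u m <= t m)%E].
Proof.
move=> t0 tcvg; rewrite compact_ultra => F UF FC.
have PF : ProperFilter F by exact: ultra_proper.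
have /choice[l ul] : forall n, exists z : (scalars R k)^o, u n @[u --> F] --> z.
  move=> n; have [C cC MC] := @compact_modulus_le R k (fine (t 0%N)).
  move: cC; rewrite compact_ultra => /(_ _ (ultra_fmap (fun u : ell1 R k => u n) UF)).
  case=> [|z [_ uz]]; last by exists z.
  move: FC; apply: (@filterS _ F) => u ut; apply: MC => /=.
  rewrite -lee_fin fineK.
    apply: (le_trans (modulus_le_tail_sum u n)).
    exact: le_trans (tail_sum_anti _ (leq0n n)) (ut 0%N).
  by rewrite ge0_fin_numE//; exact: le_trans (tail_sum_ge0 _ _) (ut 0%N).
have lt m : (tail_sum l m <= t m)%E.
  apply: (@tail_sum_ptws_lim R k _ F _ (@ell1_seq R k) l m (t m)) ul _.
  by move: FC; apply: (@filterS _ F) => u; exact.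
have ls : abs_summable l by exact: le_lt_trans (lt 0%N) t0.
exists (ell1_of ls); split=> //=.
apply/(@ell1_cvgP R k _ F _ id) => e e0.
have [m tm] : exists m, (t m <= (e / 4)%:E)%E.
  have t_ge0 n : (0 <= t n)%E by exact: le_trans (tail_sum_ge0 _ _) (lt n).
  have e4 : 0 < e / 4 by rewrite divr_gt0.
  have [m _ tm] := (cvge0_ge0P t_ge0).1 tcvg _ e4.
  by exists m; exact: tm (leqnn m).
have head : \sum_(0 <= n < m) modulus (l n - u n) @[u --> F] --> (0 : R).
  rewrite -[0 in X in _ --> X](@big1_eq R 0 +%R _ (index_iota 0 m) xpredT).
  apply: cvg_big => [|n _]; first exact: add_continuous.
  rewrite -(@modulus0 R k); apply: modulus_cvg.
  rewrite -(subrr (l n)).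
  by apply: cvgB; [exact: cvg_cst|exact: ul].
have e2 : 0 < e / 2 by rewrite divr_gt0.
near=> u.
have ut : forall n, (tail_sum u n <= t n)%E by near: u.
have hu : `|0 - \sum_(0 <= n < m) modulus (l n - u n)| <= e / 2.
  by near: u; exact: (@cvgr_dist_le R R) head _ e2.
rewrite (tail_sum_head _ m).
apply: (@le_trans _ _ ((e / 2)%:E + ((e / 4)%:E + (e / 4)%:E))%E).
  apply: leeD.
    by rewrite lee_fin (le_trans _ hu)// sub0r normrN ler_norm.
  apply: (le_trans (tail_sumB _ _ _)); apply: leeD; apply: le_trans tm.
    exact: lt.
  exact: ut.
by rewrite -!EFinD lee_fin; lra.
Unshelve. all: by end_near. Qed.

(** Dini's argument: the tails of one point tend to 0, and since the tail sums
    are 1-Lipschitz for the norm, an index that works for a point works up to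
    [e / 2] on a whole neighbourhood; compactness makes the index uniform. *)
Lemma compact_uniform_tails (R : realType) (k : scalar_kind) (A : set (ell1 R k)) :
  precompact A -> forall e : R, 0 < e ->
  \forall m \near \oo, forall u, A u -> (tail_sum u m <= e%:E)%E.
Proof.
rewrite precompactE => /compact_near_coveringP cA e e0.
suff : \forall m \near \oo, forall u, closure A u -> (tail_sum u m <= e%:E)%E.
  by apply: filterS => m h u Au; apply: h; exact: subset_closure.
apply: cA => u _.
have e2 : 0 < e / 2 by rewrite divr_gt0.
have u_tail : tail_sum u m @[m --> \oo] --> 0%E.
  apply: nneseries_tail_cvg => [|n _]; last by rewrite lee_fin modulus_ge0.
  by have := ell1_fin_num u; rewrite ge0_fin_numE ?tail_sum_ge0.
have um := (cvge0_ge0P (tail_sum_ge0 u)).1 u_tail _ e2.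
have uv : \forall v \near u, (tail_sum (u - v : ell1 R k)%R 0 <= (e / 2)%:E)%E.
  exact: (@ell1_cvgP R k _ (nbhs u) _ id u).1 (@cvg_id _ _) _ e2.
exists ([set v | (tail_sum (u - v : ell1 R k)%R 0 <= (e / 2)%:E)%E],
        [set m | (tail_sum u m <= (e / 2)%:E)%E]); first by split.
move=> [v m] /= [vu tu].
have -> : ell1_seq v = ell1_seq u - ell1_seq (u - v).
  by rewrite -[ell1_seq (u - v)]/(ell1_seq u - ell1_seq v) opprB addrC subrK.
apply: (le_trans (tail_sumB _ _ _)); rewrite (splitr e) EFinD leeD//.
by apply: le_trans vu; exact: tail_sum_anti.
Qed.

(** * Weak* 1-summable sequences as operators into ell1 *)

(** The sets that absorb [B] form a filter.  Weak* boundedness says that this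
    filter converges to 0, and convergence in the weak* topology can be tested at
    each point of [E], which avoids any explicit base of neighbourhoods. *)
Lemma weak_star_bounded (K : numFieldType) (E : tvsType K) (B : set (dual E)) :
  (forall x : E, exists M : K, forall f, B f -> `|f x| <= M) ->
  tvs_bounded B.
Proof.
move=> Bx.
pose absorbs : set_system (dual E) := fun V => exists2 r : K, 0 < r &
    forall l : K, r <= `|l| -> B `<=` ( *:%R l @` V).
have absorbs_filter : Filter absorbs.
  split.
  - exists 1 => // l l1 f _; exists (l^-1 *: f) => //.
    by rewrite scalerA divff ?scale1r// -normr_gt0 (lt_le_trans _ l1).
  - move=> V W [r r0 rV] [s s0 sW]; exists (r + s); first by rewrite addr_gt0.
    move=> l rsl f Bf.
    have rl : r <= `|l| by rewrite (le_trans _ rsl)// lerDl ltW.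
    have sl : s <= `|l| by rewrite (le_trans _ rsl)// lerDr ltW.
    have [g Vg gf] := rV l rl f Bf.
    have [h Wh hf] := sW l sl f Bf.
    have l0 : l != 0 by rewrite -normr_gt0 (lt_le_trans r0).
    have gh : g = h by apply: (scalerI l0); rewrite gf hf.
    by exists g => //; split=> //; rewrite gh.
  - move=> V W VW [r r0 rV]; exists r => // l rl f Bf.
    by have [g Vg <-] := rV l rl f Bf; exists g => //; exact: VW.
have absorbs_ptws : {ptws, (@dual_fun K E) @ absorbs --> (0 : E -> K^o)}.
  apply/pointwise_cvgP => x; apply/cvgrPdist_lt => e e0.
  have [M fM] := Bx x.
  exists ((`|M| + 1) / e); first by rewrite divr_gt0// addr_gt0.
  move=> l Ml f Bf.
  have l_gt0 : 0 < `|l| by rewrite (lt_le_trans _ Ml)// divr_gt0// ltr_wpDl.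
  have l0 : l != 0 by rewrite -normr_gt0.
  exists (l^-1 *: f); last by rewrite scalerA divff// scale1r.
  suff : `|0 - l^-1 * f x| < e by [].
  rewrite sub0r normrN normrM normfV.
  rewrite ltr_pdivrMl//.
  have fM1 : `|f x| < `|M| + 1.
    rewrite (le_lt_trans (fM f Bf))// (@le_lt_trans _ _ `|M|) ?ltrDl//.
    by rewrite ger0_norm ?fM// (le_trans _ (fM f Bf)).
  by rewrite (lt_le_trans fM1)// -ler_pdivrMr.
move=> U [W [[V oV <-] V0] WU].
have : nbhs (0 : {ptws E -> K^o}) V by apply: open_nbhs_nbhs.
by move=> /absorbs_ptws; apply: (@filterS _ absorbs).
Qed.

Section barrelled_operator.
Context {R : realType} {k : scalar_kind} {E : tvsType (scalars R k)}.
Local Notation K := (scalars R k).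

(** The coefficients are bounded one by one, not in sum, so that the moduli of
    these functionals at [x] reach every partial sum of the
    [modulus (chi n x)]. *)
Definition partial_combinations (chi : nat -> dual E) : set (dual E) :=
  [set f | exists N : nat, exists2 t : nat -> K, (forall n, modulus (t n) <= 1) &
    f = \sum_(0 <= n < N) t n *: chi n].

Lemma partial_combinations_equicontinuous (chi : nat -> dual E) :
  barrelled E -> weak_star_1_summable chi ->
  equicontinuous (partial_combinations chi) (fun f : dual E => (f : E -> K^o)).
Proof.
move=> bE chis; apply: bE; apply: weak_star_bounded => x.
have /abs_summableP[M chiM] := chis x.
exists (of_real k M) => _ [N [t t1 ->]].
rewrite -of_real_modulus ler_of_real dual_sumE.
exact: le_trans (modulus_sum_le _ _ _ t1) (chiM N).
Qed.

Variables (chi : nat -> dual E) (chis : weak_star_1_summable chi).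

Definition summing_operator (x : E) : ell1 R k := ell1_of (chis x).

Lemma summing_operator_linear : linear summing_operator.
Proof.
move=> a x y; apply: val_inj; apply/funext => n /=.
exact: linearP.
Qed.

HB.instance Definition _ :=
  GRing.isLinear.Build K E (ell1 R k) *:%R summing_operator summing_operator_linear.

(** Equicontinuity of the partial combinations, read at the combination that
    undoes the phases of the [chi n (x - y)], bounds every partial sum of the
    norm of the difference by the same [e]. *)
Lemma summing_operator_continuous : barrelled E -> continuous summing_operator.
Proof.
move=> bE x; apply/ell1_cvgP => e e0.
have e0' : 0 < of_real k e by rewrite -(of_real0 R k) ltr_of_real.
have := partial_combinations_equicontinuous bE chis x
  (@entourage_ball _ K^o (PosNum e0')).
apply: filterS => y equi; rewrite -linearB; apply/tail_sum_leP => N.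
rewrite lee_fin -(@ler_of_real R k).
have [t t1 tE] := sum_rotation (fun n => chi n (x - y)) 0 N.
(* The partial sum is nonnegative, so it is its own modulus, hence by the choice
   of [t] the modulus of a value of a functional of the family. *)
rewrite -[leLHS]ger0_norm; last first.
  by rewrite -(of_real0 R k) ler_of_real sumr_ge0// => n _; exact: modulus_ge0.
rewrite -tE -dual_sumE linearB; apply/ltW.
by apply: equi; exists N, t.
Qed.

End barrelled_operator.

Section coordinates.
Context {R : realType} {k : scalar_kind} {E : tvsType (scalars R k)}.
Variables (T : {linear E -> ell1 R k}) (cT : continuous T).

Lemma coordinate_in_dual n : (fun x => T x n) \in @dual_pred (scalars R k) E.
Proof.
rewrite inE /=; split=> [a x y|x]; first by rewrite linearP.
apply/cvgrPdist_le => e e0.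
have := (ell1_cvgP (FF := nbhs_filter x) T (T x)).1 (@cT x) _ (modulus_gt0 e0).
apply: filterS => y ty; rewrite -[leRHS](ge0_of_real (ltW e0)) -of_real_modulus ler_of_real.
rewrite -lee_fin; apply: le_trans ty.
apply: (le_trans (modulus_le_tail_sum (T x - T y : ell1 R k) n)).
exact: tail_sum_anti.
Qed.

Definition coordinate n : dual E := Dual (coordinate_in_dual n).

Lemma coordinate_summable : weak_star_1_summable coordinate.
Proof. by move=> x; have := valP (T x); rewrite inE. Qed.

Lemma bounded_ell1_image (A : set E) : tvs_bounded A ->
  exists M : R, forall x, A x -> (tail_sum (T x) 0 <= M%:E)%E.
Proof.
move=> /(_ [set x | `|T x| <= 1]) [|r r0 /(_ r)].
  have := (ell1_cvgP (FF := nbhs_filter 0) T (T 0)).1 (@cT 0) _ ltr01.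
  apply: filterS => x; rewrite -(@ell1_norm_le R k _ 1) linear0 sub0r normrN.
  by rewrite of_real1.
rewrite (ger0_norm (ltW r0)) => /(_ (lexx r)) Ar.
exists (modulus r) => _ /Ar [y Ty <-].
rewrite -ell1_norm_le linearZ normrZ (ge0_of_real (ltW r0)) (ger0_norm (ltW r0)).
by rewrite ler_piMr ?(ltW r0).
Qed.

End coordinates.

(** * The equivalence *)

Unset Implicit Arguments.

(* [precompact] of MathComp-Analysis is relative compactness (the closure is
   compact), not total boundedness. *)
Theorem proposition3p13 (R : realType) (k : scalar_kind)
    (E : tvsType (scalars R k)) (hE : hausdorff_space E) (bE : barrelled E)
    (A : set E) (A0 : A !=set0) (bA : tvs_bounded A) :
  (limited_1_infty A <->
   forall T : {linear E -> ell1 R k}, continuous T -> precompact (T @` A)) /\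
  (limited_1_infty A <->
   forall chi : nat -> dual E, weak_star_1_summable chi ->
     ereal_sup [set tail_sum (fun n => chi n x) m | x in A] @[m --> \oo]
       --> 0%E).
Proof.
have supP (chi : nat -> dual E) := @ereal_sup_cvg0P R E A
  (fun m x => tail_sum (fun n => chi n x) m) A0 (fun m x => tail_sum_ge0 _ _).
have i_iii : limited_1_infty A -> forall chi : nat -> dual E,
    weak_star_1_summable chi ->
    ereal_sup [set tail_sum (fun n => chi n x) m | x in A] @[m --> \oo] --> 0%E.
  move=> limA chi chis; apply/supP => e e0.
  have [m chim] := limited_uniform_tails limA chis e0.
  exists m => // n mn x Ax; apply: le_trans (chim x Ax); exact: tail_sum_anti.
have iii_i : (forall chi : nat -> dual E, weak_star_1_summable chi ->
    ereal_sup [set tail_sum (fun n => chi n x) m | x in A] @[m --> \oo] --> 0%E) ->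
    limited_1_infty A.
  move=> tailA; split=> // chi /tailA/supP chie.
  apply/ereal_sup_cvg0P => // [n x|e /chie]; first by rewrite lee_fin modulus_ge0.
  apply: filterS => n tailn x Ax.
  exact: le_trans (modulus_le_tail_sum _ _) (tailn x Ax).
split; last by split.
split=> [limA T cT|compA].
  have tailT := i_iii limA _ (coordinate_summable cT).
  have [M TM] := bounded_ell1_image cT bA.
  (* The image of [A] lies in the set of sequences whose tails are dominated by
     the suprema [t]; boundedness of [A] makes [t 0] finite. *)
  pose t m := ereal_sup [set tail_sum (T x) m | x in A].
  apply: (@precompact_subset _ _ [set u : ell1 R k | forall m, (tail_sum u m <= t m)%E]).
    by move=> _ [x Ax <-] m; apply: ereal_sup_ubound; exists x.
  apply: compact_precompact; first exact: norm_hausdorff.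
  apply: ell1_compact_tails => //.
  apply: (@le_lt_trans _ _ M%:E); last exact: ltry.
  by apply: ge_ereal_sup => _ [x Ax <-]; exact: TM.
apply: iii_i => chi chis; apply/supP => e e0.
have /compA/compact_uniform_tails/(_ e e0) := summing_operator_continuous (chis := chis) bE.
by apply: filterS => m tailm x Ax; apply: (tailm (summing_operator chis x)); exists x.
Qed.
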